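(* Let $\mathcal X$ (inputs) and $\mathcal Y$ (labels) be standard Borel spaces. Let $(X,Y)$ have a joint ''retain'' law whose $X$-marginal is $p^r$, and let $\eta_x:=\mathcal L(Y\mid X=x)$ be its regular conditional law. Let $p^u$ be a probability measure on $\mathcal X$, $\alpha\in(0,1]$, and $p^d:=(1-\alpha)p^r+\alpha p^u$. Let $\mathcal H$ be a measurable space and $Q:\mathcal H\times\mathcal X\to\mathcal P(\mathcal Y)$, $(\theta,x)\mapsto Q_\theta(\cdot\mid x)$, a Markov kernel (the predictive distribution of model $\theta$). For an $\mathcal H$-valued random element $\Theta$ and a probability measure $p$ on $\mathcal X$, let $\mu_\Theta^p$ denote the law of $\hat Y$ where $X\sim p$ is independent of $\Theta$ and, conditionally on $(\Theta,X)$, $\hat Y\sim Q_\Theta(\cdot\mid X)$. Define the (averaged) log-loss regret $$\overline{\mathrm{reg}}_{\log}(\Theta):=\mathbb E_\Theta\int_{\mathcal X}D_{\mathrm{KL}}\big(\eta_x\,\Vert\,Q_\Theta(\cdot\mid x)\big)\,p^r(dx).$$ Let $\pi\in(0,1)$ and let $(X_{\mathrm{margin}},Z)$ satisfy $Z\sim\mathrm{Bernoulli}(\pi)$, $\mathcal L(X_{\mathrm{margin}}\mid Z=1)=p^r$, $\mathcal L(X_{\mathrm{margin}}\mid Z=0)=p^d$. Let $\Theta_u,\Theta_r$ be $\mathcal H$-valued random elements, with $\Theta_u$ independent of $(X_{\mathrm{margin}},Z)$, and let $\hat Y_{\mathrm{margin}}$ satisfy $\hat Y_{\mathrm{margin}}\mid(\Theta_u,X_{\mathrm{margin}},Z)\sim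 Q_{\Theta_u}(\cdot\mid X_{\mathrm{margin}})$. Assume $\overline{\mathrm{reg}}_{\log}(\Theta_u)\le\delta$, $\overline{\mathrm{reg}}_{\log}(\Theta_r)\le\delta_g$, and $I(\hat Y_{\mathrm{margin}};Z)\le\varepsilon_u$. Then $$\mathrm{TV}\big(\mu_{\Theta_u}^{p^d},\mu_{\Theta_r}^{p^d}\big)\le\sqrt{\tfrac12}\big(\sqrt\delta+\sqrt{\delta_g}\big)+\sqrt{\frac{\varepsilon_u}{2\pi(1-\pi)}}+\mathrm{TV}\big(\mu_{\Theta_r}^{p^r},\mu_{\Theta_r}^{p^d}\big).$$
   Context: $\mathrm{TV}(P,Q)=\sup_A|P(A)-Q(A)|$. $D_{\mathrm{KL}}$ is Kullback–Leibler divergence and $I$ is mutual information; both computed with the same logarithm base (base 2 in the paper; the bound also holds with natural logarithms). Interpretation: $\Theta_u$ is the unlearned model, $\Theta_r$ the model retrained on the retain set, $p^r$ the retain distribution, $p^u$ the unlearn distribution. *)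

(* Defs.v *)
From HB Require Import structures.
From mathcomp Require Import all_boot all_order all_algebra.
From mathcomp Require Import all_classical all_reals all_analysis measurable_realfun.
Set Implicit Arguments. Unset Strict Implicit. Unset Printing Implicit Defensive.
Import Order.TTheory GRing.Theory Num.Theory.
Local Open Scope classical_set_scope.
Local Open Scope ring_scope.

(* Standard Borel space: Borel-isomorphic to a Borel subset of the reals
   (Kuratowski: equivalent to being Borel-isomorphic to a Borel subset of a
   Polish space). *)
Definition standard_borel (R : realType) d (T : measurableType d) : Prop :=
  exists (f : T -> R) (B : set R),
    [/\ measurable B, measurable_fun [set: T] f, injective f,
        f @` [set: T] = B & forall A, measurable A -> measurable (f @` A)].

Definition law d d' (T : measurableType d) (T' : measurableType d')
  (R : realType) (P : set T -> \bar R) (f : T -> T') : set T' -> \bar R :=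
  fun A => P (f @^-1` A).

Definition TV d (T : measurableType d) (R : realType)
  (P Q : set T -> \bar R) : \bar R :=
  ereal_sup [set (`|P A - Q A|)%E | A in measurable].

(* Kullback-Leibler divergence (natural logarithm):
   KL(P||Q) = \int log (dP/dQ) dP if P << Q (i.e. P has a density f w.r.t. Q),
   and +oo otherwise.  Densities are unique Q-a.e., so the set below is a
   singleton when a density exists and empty otherwise (inf of empty = +oo). *)
Definition KL d (T : measurableType d) (R : realType)
  (P Q : set T -> \bar R) : \bar R :=
  ereal_inf [set v | exists f : T -> \bar R,
    [/\ measurable_fun [set: T] f, (forall x, (0 <= f x)%E),
        (forall A, measurable A -> P A = (\int[Q]_(x in A) f x)%E) &
        v = (\int[P]_x (ln (fine (f x)))%:E)%E]].

Definition mutual_info dO d1 d2 (O : measurableType dO)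
  (T1 : measurableType d1) (T2 : measurableType d2) (R : realType)
  (P : set O -> \bar R) (U : O -> T1) (V : O -> T2) : \bar R :=
  KL (law P (fun w => (U w, V w)))
     ((law P U) \x (law P V))%E.

(* mu_Theta^p : law of Yhat where X ~ p independent of Theta ~ PTh and
   Yhat | (Theta, X) ~ Q_Theta(. | X). *)
Definition pred_law dH dX dY (H : measurableType dH) (X : measurableType dX)
  (Y : measurableType dY) (R : realType) (Q : R.-pker (H * X) ~> Y)
  (PTh : set H -> \bar R) (p : set X -> \bar R) : set Y -> \bar R :=
  fun B => (\int[PTh]_th \int[p]_x Q (th, x) B)%E.

Definition reg_log dH dX dY (H : measurableType dH) (X : measurableType dX)
  (Y : measurableType dY) (R : realType) (eta : R.-pker X ~> Y)
  (Q : R.-pker (H * X) ~> Y) (pr : set X -> \bar R)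
  (PTh : set H -> \bar R) : \bar R :=
  (\int[PTh]_th \int[pr]_x KL (eta x) (Q (th, x)))%E.

(* Main.v *)
Require Import Defs.
From HB Require Import structures.
From mathcomp Require Import all_boot all_order all_algebra.
From mathcomp Require Import all_classical all_reals all_analysis measurable_realfun.
From mathcomp Require Import ring lra.
Import Order.TTheory GRing.Theory Num.Theory.
Import numFieldNormedType.Exports.
Local Open Scope classical_set_scope.
Local Open Scope ring_scope.
Set Implicit Arguments. Unset Strict Implicit. Unset Printing Implicit Defensive.

(* For each measurable B, |mu_u^pd(B) - mu_r^pd(B)| is bounded by the triangle
   inequality through mu_u^pr(B), the retain label probability of B, and
   mu_r^pr(B).  The two middle gaps are controlled by the regrets, using
   Pinsker's inequality pointwise in (theta, x) and then Jensen's inequality.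
   The first gap, d, is controlled by the mutual information: with
   m = P(Yhat in B), the pairs (1_B(Yhat), Z) carry at least
   2 pi (mu^pr(B) - m)^2 + 2 (1 - pi) (mu^pd(B) - m)^2 = 2 pi (1 - pi) d^2.
   Both lower bounds on the divergence come from the Donsker-Varadhan principle
   (if E_Q[exp c] <= 1 then E_P[c] <= KL(P || Q)) with the test functions
   suggested by Hoeffding's lemma, which avoids all degenerate cases of
   p ln(p / q). *)

(** * Hoeffding's lemma for a Bernoulli variable *)

Section hoeffding.
Context {R : realType}.
Variable q : R.
Hypothesis q01 : 0 <= q <= 1.
(** The moment generating function of Bernoulli([q]). *)
Let D (s : R) : R := 1 - q + q * expR s.

Let D_gt0 s : 0 < D s.
Proof.
rewrite /D; have es := expR_gt0 s; move: q01 => /andP[q0 q1].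
have [->|q1'] := eqVneq q 1; first lra.
have := mulr_ge0 q0 (ltW es); have : q < 1 by rewrite lt_neqAle q1'.
lra.
Qed.

Let is_derive_D (s : R) : is_derive s (1 : R) D (q * expR s).
Proof.
rewrite /D; apply: is_derive_eq; rewrite /= ?scaler0 /GRing.scale/=; ring.
Qed.

(** The derivative of [g] below, with [q * expR s / D s] rewritten as [1 - (1 - q) / D s] so that
    only the denominator depends on [s]. *)
Let k (s : R) : R := s / 4 + q - 1 + (1 - q) * (D s)^-1.

Let is_derive_k (s : R) : is_derive s (1 : R) k (4^-1 - (1 - q) * (q * expR s) / (D s) ^+ 2).
Proof.
have DV : is_derive s (1:R) (fun s => (D s)^-1) (- (D s) ^- 2 *: (q * expR s)).
  by apply: is_deriveV; [rewrite gt_eqF|exact: is_derive_D].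
rewrite /k; apply: is_derive_eq; rewrite /= ?scaler0 /GRing.scale/=; ring.
Qed.

(** The gap between [s ^+ 2 / 8] and the log-moment generating function of the centred Bernoulli
    variable. *)
Let g (s : R) : R := s ^+ 2 / 8 + s * q - ln (D s).

Let is_derive_g (s : R) : is_derive s (1 : R) g (k s).
Proof.
have L : is_derive s (1:R) (fun s => ln (D s)) ((D s)^-1 * (q * expR s)).
  have lnD := is_derive1_ln (D_gt0 s).
  exact: (is_derive1_comp lnD (is_derive_D s)).
rewrite /g; apply: is_derive_eq; rewrite /= ?scaler0 /GRing.scale/= /k.
have := D_gt0 s; set e := expR s => D0.
have -> : q * e = D s - (1 - q) by rewrite /D -/e; ring.
by field; lra.
Qed.

(** Both [g] and its derivative [k] vanish at 0, and [k] has a nonnegative derivative; integrating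
    the sign twice gives [0 <= g s], which is then exponentiated. *)
Lemma hoeffding_ge0 (s : R) : 0 <= s ->
  q * expR (s * (1 - q)) + (1 - q) * expR (- (s * q)) <= expR (s ^+ 2 / 8).
Proof.
have nd (f f' : R -> R) : (forall t, is_derive t (1:R) f (f' t)) -> f 0 = 0 ->
    (forall t, 0 <= t -> 0 <= f' t) -> forall t, 0 <= t -> 0 <= f t.
  move=> ff' f0 f'0 t t0; rewrite -f0.
  apply: (@ger0_derive1_ndecry _ f 0) => //.
  - by move=> x; rewrite in_itv/= andbT => x0; rewrite derive1E derive_val f'0// ltW.
  - apply: continuous_subspaceT => x.
    exact/differentiable_continuous/derivable1_diffP.
have k0 : forall t, 0 <= t -> 0 <= k t.
  apply: (nd k _ is_derive_k).
    by rewrite /k /D expR0 mulr1 subrK invr1; ring.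
  move=> t t0; have := D_gt0 t; set d := D t => d0.
  have -> : q * expR t = d - (1 - q) by rewrite /d /D; ring.
  (* With [w = (1 - q) / d], the tilted variance is [w (1 - w)], and [1/4 - w (1 - w)] is a perfect
     square. *)
  have -> : 4^-1 - (1 - q) * (d - (1 - q)) / d ^+ 2 = ((1 - q) / d - 2^-1) ^+ 2.
    by field; lra.
  exact: sqr_ge0.
move=> s0; have : 0 <= g s.
  apply: (nd g k is_derive_g) => //.
  by rewrite /g /D expR0 mulr1 subrK ln1; ring.
rewrite /g subr_ge0 -ler_expR lnK ?posrE// => h.
have -> : q * expR (s * (1 - q)) + (1 - q) * expR (- (s * q)) = D s * expR (- (s * q)).
  have -> : s * (1 - q) = s + - (s * q) by ring.
  by rewrite expRD /D; ring.
by rewrite expRN ler_pdivrMr ?expR_gt0// -expRD.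
Qed.

End hoeffding.

(** Exchanging the two outcomes sends [(q, s)] to [(1 - q, - s)], which reduces negative [s] to the
    previous case. *)
Lemma hoeffding_two_point {R : realType} (q s : R) : 0 <= q <= 1 ->
  q * expR (s * (1 - q)) + (1 - q) * expR (- (s * q)) <= expR (s ^+ 2 / 8).
Proof.
move=> q01; have [s0|s0] := leP 0 s; first exact: hoeffding_ge0.
have q01' : 0 <= 1 - q <= 1 by lra.
have := @hoeffding_ge0 R (1 - q) q01' (- s).
have -> : - s * (1 - (1 - q)) = - (s * q) by ring.
have -> : - (- s * (1 - q)) = s * (1 - q) by ring.
by rewrite subKr sqrrN addrC; apply; rewrite oppr_ge0 ltW.
Qed.

(** The normalised form, in which the exponents are a test function admissible for
    Donsker-Varadhan. *)
Lemma hoeffding_two_point_le1 {R : realType} (q s : R) : 0 <= q <= 1 ->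
  q * expR (s * (1 - q) - s ^+ 2 / 8) + (1 - q) * expR (- (s * q) - s ^+ 2 / 8) <= 1.
Proof.
move=> q01; rewrite !expRB !mulrA -mulrDl ler_pdivrMr ?expR_gt0// mul1r.
exact: hoeffding_two_point.
Qed.

(* No measurability is assumed: this is what allows KL(eta_x || Q_theta), whose
   measurability in (theta, x) is not known, under the integral signs of
   reg_log. *)
Lemma ge0_le_lower_integral d (T : measurableType d) (R : realType)
    (mu : {measure set T -> \bar R}) (f g : T -> \bar R) :
  (forall x, 0 <= f x)%E -> (forall x, f x <= g x)%E ->
  (\int[mu]_x f x <= \int[mu]_x g x)%E.
Proof.
move=> f0 fg; rewrite !ge0_integralTE//; last first.
  by move=> x; exact: le_trans (f0 x) (fg x).
apply: le_ereal_sup => _ [h hf <-]; exists h => // x.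
exact: le_trans (hf x) (fg x).
Qed.

(** * Densities and the Donsker-Varadhan inequality *)

Section density.
Import HBNNSimple.
Context d (T : measurableType d) (R : realType).
Variables (P Q : {measure set T -> \bar R}) (f : T -> \bar R).
Hypotheses (mf : measurable_fun setT f) (f0 : forall x, (0 <= f x)%E)
  (Pf : forall A, measurable A -> P A = (\int[Q]_(x in A) f x)%E).
Local Open Scope ereal_scope.

(** The left side is a supremum over simple functions below [h]; for each of these, [Pf] on the
    level sets gives equality. *)
Lemma density_ge0_integral_le (h : T -> \bar R) :
    measurable_fun setT h -> (forall x, 0 <= h x) ->
  \int[P]_x h x <= \int[Q]_x (h x * f x).
Proof.
move=> mh h0; rewrite [leLHS]ge0_integralTE//.
apply: ge_ereal_sup => _ [k kh <-].
have mk r : measurable (k @^-1` [set r]) by exact: measurable_sfunP.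
apply: (@le_trans _ _ (\int[Q]_x ((k x)%:E * f x))); last first.
  apply: ge0_le_integral => //.
  - by move=> x _; rewrite mule_ge0// lee_fin.
  - by apply: emeasurable_funM => //; exact/measurable_EFinP.
  - exact: emeasurable_funM.
  - by move=> x _; rewrite lee_wpmul2r.
rewrite sintegralE.
under [leRHS]eq_integral => x _.
  rewrite fimfunE -fsumEFin//.
  rewrite ge0_mule_fsuml; last by move=> y; exact: nnfun_muleindic_ge0.
  over.
rewrite ge0_integral_fsum//; last 2 first.
  - move=> y; apply: emeasurable_funM => //.
    by apply/measurable_EFinP; exact: measurable_funM.
  - by move=> m y Ey; rewrite mule_ge0// nnfun_muleindic_ge0.
rewrite le_eqVlt; apply/orP; left; apply/eqP; apply: eq_fsbigr => r rk.
under eq_integral do rewrite EFinM -muleA.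
rewrite ge0_integralZl//; first last.
- by move: rk; rewrite inE => -[t _ <-]; rewrite lee_fin.
- by move=> x _; rewrite mule_ge0// lee_fin.
- by apply: emeasurable_funM => //; exact/measurable_EFinP.
congr (_ * _); rewrite Pf// [LHS]integral_mkcond; apply: eq_integral => x _.
by rewrite epatch_indic muleC.
Qed.

End density.

Section donsker_varadhan.
Context d (T : measurableType d) (R : realType).
Variables (P Q : probability T R).
Local Open Scope ereal_scope.

(** One density [f] is treated at a time, the infimum over no density being +oo. A pointwise lower
    bound on [ln f] is integrated against [P], and [E_P[exp c / f] <= E_Q[exp c] <= 1] absorbs its
    constant 1. *)
Lemma donsker_varadhan (c : T -> R) :
    P.-integrable setT (EFin \o c) -> measurable_fun setT c ->
    \int[Q]_x (expR (c x))%:E <= 1 ->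
  \int[P]_x (c x)%:E <= KL P Q.
Proof.
move=> ic mc Qc; apply: le_ereal_inf_tmp => _ [f [mf f0 Pf ->]].
have intf : Q.-integrable setT f.
  apply/integrableP; split => //.
  under eq_integral do rewrite gee0_abs//.
  by rewrite -Pf// probability_setT ltry.
(* 1 + t <= exp t at t = c - ln f gives c + 1 - exp c / f <= ln f. *)
pose h x := (expR (c x) / fine (f x))%R.
have mff : measurable_fun setT (fine \o f) by exact: measurableT_comp.
have mh : measurable_fun setT h.
  apply: measurable_funM; first exact: measurableT_comp.
  under eq_fun do rewrite -powR_inv1 ?fine_ge0//.
  exact: (measurableT_comp (measurable_powR _) mff).
have h0 x : (0 <= h x)%R by rewrite divr_ge0 ?expR_ge0 ?fine_ge0.
have Ph : \int[P]_x (h x)%:E <= 1.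
  apply: le_trans Qc; apply: (le_trans (density_ge0_integral_le mf f0 Pf _ _)) => //.
    exact/measurable_EFinP.
  apply: ge0_le_integral => //.
  - by move=> x _; rewrite mule_ge0// lee_fin.
  - by apply: emeasurable_funM => //; exact/measurable_EFinP.
  - by apply/measurable_EFinP; exact: measurableT_comp.
  (* If [f x] is 0 or +oo, then [fine (f x)] is 0, so [h x] is 0 by the convention on inverses and
     the product vanishes. *)
  - move=> x _; rewrite /h; move: (f0 x); case: (f x) => [r| |]//= r0.
      rewrite -EFinM lee_fin; have [->|rn0] := eqVneq r 0%R.
        by rewrite mulr0 expR_ge0.
      by rewrite divfK.
    by rewrite invr0 mulr0 mul0e lee_fin expR_ge0.
have ih : P.-integrable setT (EFin \o h).
  apply/integrableP; split; first exact/measurable_EFinP.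
  under eq_integral => x _ do rewrite gee0_abs ?lee_fin//.
  by rewrite (le_lt_trans Ph)// ltry.
pose u x := (ln (fine (f x)))%:E.
pose v x := (c x)%:E + 1 - (h x)%:E.
have i1 : P.-integrable setT (fun=> 1).
  exact: (@finite_measure_integrable_cst _ _ _ P setT 1%R measurableT).
have ic1 : P.-integrable setT (fun x => (c x)%:E + 1) by exact: integrableD.
have iv : P.-integrable setT v by exact: integrableB.
have mu : measurable_fun setT u.
  by apply/measurable_EFinP; exact: measurableT_comp.
have vu : {ae P, forall x, v x <= u x}.
  (* The tangent bound needs [0 < fine (f x)]. The exceptional set [N] is [P]-null: [f] is finite
     [Q]-a.e., hence 0 [Q]-a.e. on [N], and [P N] is its integral there. *)
  pose N := (fine \o f) @^-1` [set 0%R].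
  have mN : measurable N by rewrite -[N]setTI; exact: mff.
  exists N; split => //.
    rewrite Pf// (@ge0_ae_eq_integral _ _ _ Q N f (cst 0))//.
    - exact: integral0.
    - exact: measurable_funTS.
    - have := integrable_ae measurableT intf.
      apply: filterS => x + Nx => /(_ I) fx.
      by rewrite /= -(fineK fx) (_ : fine (f x) = 0%R).
  move=> x /=; apply: contra_notP => Nx.
  have fx : (0 < fine (f x))%R.
    by rewrite lt_neqAle fine_ge0// andbT eq_sym; apply/eqP.
  have -> : v x = (c x + 1 - h x)%:E by [].
  rewrite /u lee_fin /h.
  have := expR_ge1Dx (c x - ln (fine (f x))).
  by rewrite expRB lnK//; lra.
apply: (@le_trans _ _ (\int[P]_x v x)).
  have I1 : \int[P]_x (fun=> 1) x = 1.
    by rewrite (integral_cst P measurableT) mul1e; exact: probability_setT.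
  rewrite integralB// integralD// I1.
  by rewrite leeBrDr ?leeD2l//; exact: integrable_fin_num ih.
(* Integrability of [u] is not established, so positive and negative parts are compared
   separately. *)
rewrite [leLHS]integralE [leRHS]integralE; apply: leeB.
- apply: ae_ge0_le_integral => //.
  + exact/measurable_funepos/(measurable_int _ iv).
  + exact: measurable_funepos.
  + by apply: filterS vu => x vux _; rewrite !funepos.unlock ge_max !le_max vux lexx orbT.
- apply: ae_ge0_le_integral => //.
  + exact: measurable_funeneg.
  + exact/measurable_funeneg/(measurable_int _ iv).
  + by apply: filterS vu => x vux _; rewrite !funeneg.unlock ge_max !le_max leeN2 vux lexx orbT.
Qed.

End donsker_varadhan.

(** * Divergence bounds from finite-valued test functions *)

Section finite_valued.
Context d (T : measurableType d) (R : realType).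
Variables (I : finType) (phi : T -> I).
Hypothesis mphi : forall i, measurable (phi @^-1` [set i]).

Lemma measurable_finite_valued (g : I -> R) : measurable_fun setT (g \o phi).
Proof.
move=> _ B mB; rewrite setTI.
have -> : (g \o phi) @^-1` B = \bigcup_(i in g @^-1` B) (phi @^-1` [set i]).
  by apply/seteqP; split => [x gx|x [i gi phixi]]; [by exists (phi x)|by rewrite /= phixi].
by apply: fin_bigcup_measurable.
Qed.

Variable P : probability T R.

Lemma integrable_finite_valued (g : I -> R) :
  P.-integrable setT (EFin \o (g \o phi)).
Proof.
apply: measurable_bounded_integrable => //.
- by rewrite (le_lt_trans (probability_le1 P measurableT)) ?ltry.
- exact: measurable_finite_valued.
exists (\sum_i `|g i|); split; first exact: num_real.
move=> M hM x _ /=; rewrite (le_trans _ (ltW hM))//.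
by rewrite (bigD1 (phi x))//= lerDl sumr_ge0.
Qed.

Lemma integral_finite_valued (g : I -> R) :
  (\int[P]_x (g (phi x))%:E)%E = (\sum_i g i * fine (P (phi @^-1` [set i])))%:E.
Proof.
transitivity (\int[P]_x (\sum_i (g i)%:E * (\1_(phi @^-1` [set i]) x)%:E))%E.
  apply: eq_integral => x _.
  rewrite (bigD1 (phi x))//= big1 ?adde0.
    by rewrite indicE mem_set// mule1.
  move=> i iphi; rewrite indicE memNset ?mule0//= => phii.
  by rewrite phii eqxx in iphi.
have i1 i : P.-integrable setT (fun x => (\1_(phi @^-1` [set i]) x)%:E).
  exact: integrable_indic.
rewrite integral_sum//; last by move=> i; exact: integrableZl.
rewrite -sumEFin; apply: eq_bigr => i _.
rewrite integralZl// integral_indic// setIT EFinM fineK//.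
exact: fin_num_measure.
Qed.

End finite_valued.

(** For a test function factoring through a finite partition, integrability is automatic and both
    expectations are finite sums. *)
Lemma donsker_varadhan_finite d (T : measurableType d) (R : realType)
    (I : finType) (phi : T -> I) (mphi : forall i, measurable (phi @^-1` [set i]))
    (P Q : probability T R) (g : I -> R) :
  \sum_i expR (g i) * fine (Q (phi @^-1` [set i])) <= 1 ->
  ((\sum_i g i * fine (P (phi @^-1` [set i])))%:E <= KL P Q)%E.
Proof.
move=> h; rewrite -integral_finite_valued//; apply: (donsker_varadhan (c := g \o phi)).
- exact: integrable_finite_valued.
- exact: measurable_finite_valued.
- by rewrite (integral_finite_valued mphi Q (expR \o g)) lee_fin.
Qed.

(** The test function is [s (1_B - q) - s^2 / 8], admissible by Hoeffding's lemma. *)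
Lemma pinsker d (T : measurableType d) (R : realType) (P Q : probability T R)
    (B : set T) : measurable B ->
  ((2 * (fine (P B) - fine (Q B)) ^+ 2)%:E <= KL P Q)%E.
Proof.
move=> mB.
pose phi x := x \in B.
have phit : phi @^-1` [set true] = B.
  by apply/seteqP; split => x /= Bx; [exact: set_mem|exact: mem_set].
have phif : phi @^-1` [set false] = ~` B.
  by rewrite -phit; apply/seteqP; split => x /=; case: (phi x).
have fP (P' : probability T R) : fine (P' (~` B)) = 1 - fine (P' B).
  by rewrite probability_setC// fineB//; exact: fin_num_measure.
have q01 : 0 <= fine (Q B) <= 1.
  rewrite fine_ge0//= -lee_fin fineK ?probability_le1//.
  exact: fin_num_measure.
set p := fine (P B); set q := fine (Q B).
(* This [s] maximises the [P]-expectation [s (p - q) - s^2 / 8], with value [2 (p - q)^2]. *)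
pose s := 4 * (p - q).
pose g b := (if b then s * (1 - q) else - (s * q)) - s ^+ 2 / 8.
have -> : 2 * (p - q) ^+ 2 = \sum_i g i * fine (P (phi @^-1` [set i])).
  by rewrite big_bool /= phit phif fP -/p /g /s; field.
have mphi : forall i, measurable (phi @^-1` [set i]).
  by case; [rewrite phit|rewrite phif; exact: measurableC].
apply: (donsker_varadhan_finite mphi).
rewrite big_bool /= phit phif fP -/q.
have := hoeffding_two_point_le1 s q01.
by rewrite [q * _]mulrC [(1 - q) * _]mulrC.
Qed.

(** Here [a] and [b] stand for the conditional probabilities of [U] in [B] given [V] true and [V]
    false. Pinsker's test function is used for each value of [V] against the common mean [m]. *)
Lemma mutual_info_bool_ge dO d1 (O : measurableType dO) (T1 : measurableType d1)
    (R : realType) (P : probability O R) (U : {mfun O >-> T1})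
    (V : {mfun O >-> bool}) (B : set T1) (pi a b : R) :
  measurable B ->
  P (V @^-1` [set true]) = pi%:E ->
  P (U @^-1` B `&` V @^-1` [set true]) = (pi * a)%:E ->
  P (U @^-1` B `&` V @^-1` [set false]) = ((1 - pi) * b)%:E ->
  ((2 * pi * (1 - pi) * (a - b) ^+ 2)%:E <= mutual_info P U V)%E.
Proof.
move=> mB PV1 PB1 PB0.
have mU A : measurable A -> measurable (U @^-1` A) by exact: measurable_funPTI.
have mV A : measurable (V @^-1` A) by exact: measurable_funPTI.
have mUV : measurable_fun setT (fun w => (U w, V w)) by exact: measurable_fun_pair.
(* Bundling the pair makes its law a [probability], as Donsker-Varadhan requires. *)
pose UV : {mfun O >-> (T1 * bool)%type} :=
  HB.pack (fun w => (U w, V w)) (isMeasurableFun.Build _ _ _ _ _ mUV).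
have Pfin A : measurable A -> P A \is a fin_num by move=> ?; exact: fin_num_measure.
have VC : V @^-1` [set false] = ~` (V @^-1` [set true]).
  by apply/seteqP; split => x /=; case: (V x).
have PV0 : P (V @^-1` [set false]) = (1 - pi)%:E.
  by rewrite VC probability_setC// PV1.
have Psplit z : P (~` (U @^-1` B) `&` V @^-1` [set z]) =
    (P (V @^-1` [set z]) - P (U @^-1` B `&` V @^-1` [set z]))%E.
  rewrite setIC -setDE setIC measureD//; first exact: mU.
  by rewrite ltey_eq Pfin.
have PU : P (U @^-1` B) = (pi * a + (1 - pi) * b)%:E.
  rewrite -(setIT (U @^-1` B)) -(setUv (V @^-1` [set true])) -VC setIUr measureU.
  - by rewrite EFinD; congr (_ + _)%E; [exact: PB1|exact: PB0].
  - by apply: measurableI => //; exact: mU.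
  - by apply: measurableI => //; exact: mU.
  - by apply/seteqP; split => x //= [[_ +] [_ +]]; move=> ->.
set m := pi * a + (1 - pi) * b in PU.
have m01 : 0 <= m <= 1.
  apply/andP; split; rewrite -lee_fin -PU; first exact: measure_ge0.
  by apply: probability_le1; exact: mU.
have pi01 : 0 <= pi <= 1.
  apply/andP; split; rewrite -lee_fin -PV1; first exact: measure_ge0.
  exact: probability_le1.
pose phi (yz : T1 * bool) := (yz.1 \in B, yz.2).
pose cell b := if b then B else ~` B.
have mcell b' : measurable (cell b').
  by case: b' => //=; exact: measurableC.
have phiE i : phi @^-1` [set i] = cell i.1 `*` [set i.2].
  case: i => -[] z; apply/seteqP; split => -[y z'] /=.
  - by case=> /set_mem yB ->.
  - by case=> yB ->; rewrite /phi /= mem_set.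
  - by case=> /negbT/negP yB ->; split => //= By; apply: yB; rewrite mem_set.
  - by case=> yB ->; rewrite /phi /= memNset.
have mphi i : measurable (phi @^-1` [set i]).
  by rewrite phiE; exact: measurableX.
(* The optimal slope of Pinsker's inequality, chosen separately for each value of [V]. *)
pose s (z : bool) := 4 * ((if z then a else b) - m).
pose g (i : bool * bool) :=
  (if i.1 then s i.2 * (1 - m) else - (s i.2 * m)) - s i.2 ^+ 2 / 8.
have JE i : distribution P UV (phi @^-1` [set i]) =
    ((if i.2 then pi else 1 - pi) * (if i.1 then (if i.2 then a else b)
                                     else 1 - (if i.2 then a else b)))%:E.
  rewrite phiE; case: i => -[] [] /=.
  - exact: PB1.
  - exact: PB0.
  - transitivity (P (~` (U @^-1` B) `&` V @^-1` [set true])) => //.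
    by rewrite Psplit PV1 PB1 -EFinB mulrBr mulr1.
  - transitivity (P (~` (U @^-1` B) `&` V @^-1` [set false])) => //.
    by rewrite Psplit PV0 PB0 -EFinB mulrBr mulr1.
pose M : probability (T1 * bool)%type R := (distribution P U \x distribution P V)%E.
have ME i : M (phi @^-1` [set i]) =
    ((if i.1 then m else 1 - m) * (if i.2 then pi else 1 - pi))%:E.
  transitivity (distribution P U (cell i.1) * distribution P V [set i.2])%E.
    by rewrite phiE; exact: product_measure1E.
  rewrite EFinM; congr (_ * _)%E.
    case: i.1; first exact: PU.
    rewrite [LHS](_ : _ = 1 - distribution P U B)%E; last exact: probability_setC.
    by rewrite [distribution P U B](_ : _ = m%:E).
  by case: i.2; [exact: PV1|exact: PV0].
(* This uses [a - m = (1 - pi) (a - b)] and [b - m = - pi (a - b)]. *)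
have -> : 2 * pi * (1 - pi) * (a - b) ^+ 2 =
    \sum_i g i * fine (distribution P UV (phi @^-1` [set i])).
  under eq_bigr do rewrite JE /=.
  rewrite -(pair_bigA _ (fun i j : bool => g (i, j) * ((if j then pi else 1 - pi) *
    (if i then (if j then a else b) else 1 - (if j then a else b)))))/=.
  by rewrite !big_bool /= /g /s /m /=; field.
apply: (donsker_varadhan_finite mphi (distribution P UV) (Q := M)).
under eq_bigr do rewrite ME /=.
rewrite -(pair_bigA _ (fun i j : bool => expR (g (i, j)) *
  ((if i then m else 1 - m) * (if j then pi else 1 - pi))))/=.
rewrite !big_bool /= /g /=.
have /andP[pi0 pi1] := pi01.
have pi1' : 0 <= 1 - pi by rewrite subr_ge0.
(* Under the product law the first coordinate is Bernoulli([m]) whatever the second, so the two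
   Hoeffding bounds are averaged with weights [pi] and [1 - pi]. *)
have := lerD (ler_wpM2l pi0 (hoeffding_two_point_le1 (s true) m01))
             (ler_wpM2l pi1' (hoeffding_two_point_le1 (s false) m01)).
rewrite !mulr1 subrKC.
by apply: le_trans; rewrite le_eqVlt; apply/orP; left; apply/eqP; ring.
Qed.

(** * Law of the prediction on an event of [Z] *)

Lemma ge0_integral_mrestr d (T : measurableType d) (R : realType)
    (mu : {measure set T -> \bar R}) (D : set T) (mD : measurable D) (f : T -> \bar R) :
  measurable_fun setT f -> (forall x, 0 <= f x)%E ->
  (\int[mrestr mu mD]_x f x = \int[mu]_(x in D) f x)%E.
Proof.
move=> mf f0.
rewrite (@ge0_negligible_integral _ _ _ (mrestr mu mD) setT (~` D))//.
- rewrite setDE setTI setCK; apply: eq_measure_integral => A mA AD.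
  by rewrite /= /mrestr; congr (mu _); apply/setIidPl.
- exact: measurableC.
- by rewrite /= /mrestr setICl measure0.
Qed.

(** Restricted to the event [Z = z], the pair [(Theta, Xm)] has law [w] times the product of the law
    of [Theta] and [p]; Tonelli then turns the integral of the kernel into [pred_law]. *)
Lemma joint_prediction dH dX dY dO (H : measurableType dH) (X : measurableType dX)
  (Y : measurableType dY) (Omega : measurableType dO) (R : realType)
  (Q : R.-pker (H * X) ~> Y) (P : probability Omega R)
  (Theta : {mfun Omega >-> H}) (Xm : {mfun Omega >-> X}) (Z : {mfun Omega >-> bool})
  (Ym : {mfun Omega >-> Y}) (p : probability X R) (z : bool) (w : R) :
  0 <= w ->
  (forall A, measurable A ->
     P (Xm @^-1` A `&` Z @^-1` [set z]) = (w%:E * p A)%E) ->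
  (forall (C : set H) (D : set (X * bool)%type),
     measurable C -> measurable D ->
     P (Theta @^-1` C `&` (fun w => (Xm w, Z w)) @^-1` D)
     = (P (Theta @^-1` C) * P ((fun w => (Xm w, Z w)) @^-1` D))%E) ->
  (forall (D : set (H * X * bool)%type) (B : set Y),
     measurable D -> measurable B ->
     P ((fun w => (Theta w, Xm w, Z w)) @^-1` D `&` Ym @^-1` B)
     = (\int[P]_(w in (fun w => (Theta w, Xm w, Z w)) @^-1` D)
          Q (Theta w, Xm w) B)%E) ->
  forall B, measurable B ->
  P (Ym @^-1` B `&` Z @^-1` [set z]) = (w%:E * pred_law Q (law P Theta) p B)%E.
Proof.
move=> w0 hX hind hYm B mB.
have mE : measurable (Z @^-1` [set z]) by exact: measurable_funPTI.
have mTX : measurable_fun setT (fun o => (Theta o, Xm o)) by exact: measurable_fun_pair.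
have mQB : measurable_fun setT (fun hx => Q hx B) by exact: measurable_kernel.
have mD : measurable ([set: H * X] `*` [set z]) by exact: measurableX.
have DE : (fun o => (Theta o, Xm o, Z o)) @^-1` ([set: H * X] `*` [set z]) = Z @^-1` [set z].
  by apply/seteqP; split => o /=; [case|].
rewrite setIC -[in LHS]DE hYm// DE.
rewrite -(@ge0_integral_mrestr _ _ _ P _ mE (fun o => Q (Theta o, Xm o) B))//; last first.
  exact: (measurableT_comp mQB mTX).
rewrite -(@ge0_integral_pushforward _ _ _ _ _ _ mTX (mrestr P mE) setT (fun hx => Q hx B))//.
pose wp := mscale (NngNum w0) p.
transitivity (\int[distribution P Theta \x wp]_hx Q hx B)%E.
  apply: eq_measure_integral => A mA _; apply/esym.
  (* It suffices to compare the two measures on rectangles, where independence and [hX] apply. *)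
  apply: product_measure_unique => // C D mC mD'.
  rewrite /= /pushforward /mrestr /wp /mscale/=.
  have DzE : (fun o => (Xm o, Z o)) @^-1` (D `*` [set z]) = Xm @^-1` D `&` Z @^-1` [set z].
    by [].
  have mDz : measurable (D `*` [set z]) by exact: measurableX.
  have := hind C (D `*` [set z]) mC mDz.
  rewrite DzE hX// => <-; congr (P _).
  by apply/seteqP; split => o /=; tauto.
rewrite fubini_tonelli1// /fubini_F.
transitivity (w%:E * \int[distribution P Theta]_th \int[p]_x Q (th, x) B)%E; last by [].
rewrite -ge0_integralZl//.
- apply: eq_integral => th _; rewrite ge0_integral_mscale//.
  exact: (measurable_fun_pair2 _ mQB).
- exact: (@measurable_fun_fubini_tonelli_F _ _ _ _ _ p _ mQB).
- by move=> th _; exact: integral_ge0.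
Qed.

(** * Jensen's inequality and the regret bound *)

Lemma sqr_Rintegral_le d (T : measurableType d) (R : realType) (P : probability T R)
    (h : T -> R) :
  P.-integrable setT (EFin \o h) -> P.-integrable setT (EFin \o (fun x => h x ^+ 2)) ->
  (\int[P]_x h x) ^+ 2 <= \int[P]_x (h x ^+ 2).
Proof.
move=> ih ih2; set m := \int[P]_x h x.
have ic : P.-integrable setT (EFin \o cst (m ^+ 2)).
  exact: finite_measure_integrable_cst.
have i2 : P.-integrable setT (EFin \o (fun x => 2 * m * h x)).
  exact: (integrableZl measurableT (2 * m) ih).
have P1 : fine (P setT) = 1 by rewrite probability_setT.
(* The tangent line to the square at the mean [m] lies below it and has mean [m ^+ 2]. *)
have -> : m ^+ 2 = \int[P]_x (2 * m * h x - m ^+ 2).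
  by rewrite RintegralB// RintegralZl// Rintegral_cst// P1 -/m; ring.
apply: le_Rintegral => //; first exact: (integrableB measurableT i2 ic).
move=> x _; rewrite -subr_ge0.
have -> : h x ^+ 2 - (2 * m * h x - m ^+ 2) = (h x - m) ^+ 2 by ring.
exact: sqr_ge0.
Qed.

Section pkernel_at.
Context d dY (T : measurableType d) (Y : measurableType dY) (R : realType).
Variables (k : R.-pker T ~> Y) (x : T).

(** A named copy of [k x] that carries the [probability] structure, so that [pinsker] applies to
    it. *)
Definition pkernel_at : set Y -> \bar R := k x.

HB.instance Definition _ := Measure.on pkernel_at.
HB.instance Definition _ :=
  Measure_isProbability.Build _ _ _ pkernel_at (prob_kernel x).

End pkernel_at.

Section regret.
Context dH dX dY (H : measurableType dH) (X : measurableType dX) (Y : measurableType dY)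
  (R : realType).
Variables (Q : R.-pker (H * X) ~> Y) (M : probability H R) (p : probability X R).
Variables (B : set Y) (mB : measurable B).

Lemma kernel_fineE d (T : measurableType d) (k : R.-pker T ~> Y) x :
  k x B = (fine (k x B))%:E.
Proof. by rewrite fineK//; exact: (fin_num_measure (pkernel_at k x)). Qed.

Lemma fine_kernel_itv01 d (T : measurableType d) (k : R.-pker T ~> Y) x :
  0 <= fine (k x B) <= 1.
Proof.
rewrite fine_ge0//= -lee_fin -kernel_fineE.
exact: (probability_le1 (pkernel_at k x) mB).
Qed.

Lemma measurable_fine_kernel d (T : measurableType d) (k : R.-pker T ~> Y) :
  measurable_fun setT (fun x => fine (k x B)).
Proof.
apply: measurableT_comp => //; exact: measurable_kernel.
Qed.

Lemma integrable_norm_le1 d (T : measurableType d) (P : probability T R) (h : T -> R) :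
  measurable_fun setT h -> (forall x, `|h x| <= 1) -> P.-integrable setT (EFin \o h).
Proof.
move=> mh h1; apply: measurable_bounded_integrable => //.
- by rewrite (le_lt_trans (probability_le1 P measurableT)) ?ltry.
- by exists 1; split => // t t1 x _ /=; rewrite (le_trans (h1 x))// ltW.
Qed.

Lemma integrable_fine_kernel d (T : measurableType d) (P : probability T R) (k : R.-pker T ~> Y) :
  P.-integrable setT (EFin \o (fun x => fine (k x B))).
Proof.
apply: integrable_norm_le1; first exact: measurable_fine_kernel.
by move=> x; have /andP[k0 k1] := fine_kernel_itv01 k x; rewrite ger0_norm.
Qed.

Lemma pred_lawE : pred_law Q M p B = (\int[M \x p]_z Q z B)%E.
Proof. by rewrite fubini_tonelli1//; exact: measurable_kernel. Qed.

Lemma pred_law_fin_num : pred_law Q M p B \is a fin_num.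
Proof.
rewrite pred_lawE; under eq_integral do rewrite kernel_fineE.
exact: (integrable_fin_num measurableT (integrable_fine_kernel _ _)).
Qed.

(** The gap is the mean of [h] under [M \x p]. Jensen bounds its square by the mean of [h ^+ 2], and
    Pinsker bounds [2 * h ^+ 2] pointwise by the divergence. *)
Lemma pred_law_dist_le (eta : R.-pker X ~> Y) (delta : R) :
  (reg_log eta Q p M <= delta%:E)%E ->
  `|fine (pred_law Q M p B) - fine (\int[p]_x eta x B)%E| <= Num.sqrt (delta / 2).
Proof.
move=> reg.
pose h (z : H * X) := fine (Q z B) - fine (eta z.2 B).
have mh : measurable_fun setT h.
  apply: measurable_funB; first exact: measurable_fine_kernel.
  exact: (measurableT_comp (measurable_fine_kernel eta) measurable_snd).
have h1 z : `|h z| <= 1.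
  have := fine_kernel_itv01 Q z; have := fine_kernel_itv01 eta z.2.
  by rewrite /h ler_norml; lra.
have ih : (M \x p)%E.-integrable setT (EFin \o h) by exact: integrable_norm_le1.
have ih2 : (M \x p)%E.-integrable setT (EFin \o (fun z => h z ^+ 2)).
  apply: integrable_norm_le1; first exact: measurable_funX.
  by move=> z; rewrite normrX exprn_ile1.
have meta2 : measurable_fun setT (fun z : H * X => eta z.2 B).
  exact: (measurableT_comp (measurable_kernel eta _ mB) measurable_snd).
have etaE : (\int[p]_x eta x B = \int[M \x p]_z eta z.2 B)%E.
  rewrite fubini_tonelli1// /fubini_F/=.
  by rewrite (integral_cst M measurableT) [X in (_ * X)%E](probability_setT M) mule1.
have dE : fine (pred_law Q M p B) - fine (\int[p]_x eta x B)%E = \int[(M \x p)%E]_z h z.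
  rewrite etaE pred_lawE RintegralB//.
  - by congr (fine _ - fine _); apply: eq_integral => z _; rewrite kernel_fineE.
  - exact: integrable_fine_kernel.
  - apply: integrable_norm_le1.
      exact: (measurableT_comp (measurable_fine_kernel eta) measurable_snd).
    by move=> z; have /andP[k0 k1] := fine_kernel_itv01 eta z.2; rewrite ger0_norm.
rewrite dE -sqrtr_sqr ler_wsqrtr// ler_pdivlMr// mulrC.
apply: (@le_trans _ _ (2 * \int[(M \x p)%E]_z (h z ^+ 2))).
  by rewrite ler_pM2l//; exact: (@sqr_Rintegral_le _ _ _ (M \x p)%E).
rewrite -RintegralZl// -lee_fin fineK; last first.
  exact: (integrable_fin_num measurableT (integrableZl measurableT 2 ih2)).
(* Tonelli is applied only to the measurable side [2 * h ^+ 2]; the divergence stays under its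
   iterated integral. *)
apply: le_trans reg; rewrite fubini_tonelli1//; last first.
- by move=> z; rewrite lee_fin mulr_ge0// sqr_ge0.
- by apply/measurable_EFinP; apply: measurable_funM => //; exact: measurable_funX.
apply: ge0_le_lower_integral => th.
  by apply: integral_ge0 => x _; rewrite lee_fin mulr_ge0// sqr_ge0.
apply: ge0_le_lower_integral => x.
  by rewrite lee_fin mulr_ge0// sqr_ge0.
have -> : h (th, x) = - (fine (eta x B) - fine (Q (th, x) B)) by rewrite opprB.
rewrite sqrrN; exact: (pinsker (pkernel_at eta x) (pkernel_at Q (th, x)) mB).
Qed.

End regret.

(** * Triangle inequality over the four gaps *)

Unset Implicit Arguments. Set Strict Implicit. Set Printing Implicit Defensive.

Theorem mainTheorem2
  (R : realType)
  (dX dY dH dO : measure_display)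
  (X : measurableType dX) (Y : measurableType dY)
  (H : measurableType dH) (Omega : measurableType dO)
  (hXsb : standard_borel R X) (hYsb : standard_borel R Y)
  (* retain law: X-marginal pr, regular conditional law eta_x of Y given X=x *)
  (pr : probability X R) (eta : R.-pker X ~> Y)
  (* unlearn distribution and the mixture pd = (1-alpha) pr + alpha pu *)
  (pu : probability X R) (alpha : R) (halpha : 0 < alpha <= 1)
  (pd : probability X R)
  (hpd : forall A, measurable A ->
     pd A = ((1 - alpha)%:E * pr A + alpha%:E * pu A)%E)
  (* predictive Markov kernel (theta, x) |-> Q_theta(. | x) *)
  (Q : R.-pker (H * X) ~> Y)
  (* underlying probability space and random elements *)
  (P : probability Omega R)
  (Theta_u Theta_r : {mfun Omega >-> H})
  (Xm : {mfun Omega >-> X}) (Z : {mfun Omega >-> bool})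
  (Ym : {mfun Omega >-> Y})
  (pi : R) (hpi : 0 < pi < 1)
  (delta delta_g eps_u : R)
  (* Z ~ Bernoulli(pi) *)
  (hZ : P (Z @^-1` [set true]) = pi%:E)
  (* L(Xm | Z = 1) = pr,  L(Xm | Z = 0) = pd *)
  (hX1 : forall A, measurable A ->
     P (Xm @^-1` A `&` Z @^-1` [set true]) = (pi%:E * pr A)%E)
  (hX0 : forall A, measurable A ->
     P (Xm @^-1` A `&` Z @^-1` [set false]) = ((1 - pi)%:E * pd A)%E)
  (* Theta_u independent of (Xm, Z) *)
  (hind : forall (C : set H) (D : set (X * bool)%type),
     measurable C -> measurable D ->
     P (Theta_u @^-1` C `&` (fun w => (Xm w, Z w)) @^-1` D)
     = (P (Theta_u @^-1` C) * P ((fun w => (Xm w, Z w)) @^-1` D))%E)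
  (* Ym | (Theta_u, Xm, Z) ~ Q_{Theta_u}(. | Xm) *)
  (hYm : forall (D : set (H * X * bool)%type) (B : set Y),
     measurable D -> measurable B ->
     P ((fun w => (Theta_u w, Xm w, Z w)) @^-1` D `&` Ym @^-1` B)
     = (\int[P]_(w in (fun w => (Theta_u w, Xm w, Z w)) @^-1` D)
          Q (Theta_u w, Xm w) B)%E)
  (hreg_u : (reg_log eta Q pr (law P Theta_u) <= delta%:E)%E)
  (hreg_r : (reg_log eta Q pr (law P Theta_r) <= delta_g%:E)%E)
  (hMI : (mutual_info P Ym Z <= eps_u%:E)%E) :
  (TV (pred_law Q (law P Theta_u) pd) (pred_law Q (law P Theta_r) pd)
   <= (Num.sqrt (1 / 2) * (Num.sqrt delta + Num.sqrt delta_g)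
       + Num.sqrt (eps_u / (2 * pi * (1 - pi))))%:E
      + TV (pred_law Q (law P Theta_r) pr) (pred_law Q (law P Theta_r) pd))%E.
Proof.
have /andP[pi0 pi1] := hpi.
pose Mu := distribution P Theta_u; pose Mr := distribution P Theta_r.
apply: ge_ereal_sup => _ [B mB <-].
have hu := pred_law_dist_le mB (M := Mu) (p := pr) hreg_u.
have hr := pred_law_dist_le mB (M := Mr) (p := pr) hreg_r.
set c := fine (\int[pr]_x eta x B)%E in hu hr.
pose u (p : probability X R) := fine (pred_law Q Mu p B).
pose r (p : probability X R) := fine (pred_law Q Mr p B).
have uE (p : probability X R) : pred_law Q (law P Theta_u) p B = (u p)%:E.
  by apply/esym/fineK; exact: (pred_law_fin_num Q Mu p mB).
have rE (p : probability X R) : pred_law Q (law P Theta_r) p B = (r p)%:E.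
  by apply/esym/fineK; exact: (pred_law_fin_num Q Mr p mB).
have ptwo : 0 < 2 * pi * (1 - pi) by rewrite !mulr_gt0// subr_gt0.
have hm : `|u pr - u pd| <= Num.sqrt (eps_u / (2 * pi * (1 - pi))).
  rewrite -sqrtr_sqr ler_wsqrtr// ler_pdivlMr// mulrC -lee_fin.
  (* Here [a] is [u pr] and [b] is [u pd], both identified by [joint_prediction]. *)
  apply: le_trans hMI; apply: (mutual_info_bool_ge mB hZ).
    by rewrite (joint_prediction (ltW pi0) hX1 hind hYm)// uE.
  by rewrite (joint_prediction _ hX0 hind hYm)// ?uE// subr_ge0 ltW.
have sqrt_half (e : R) : Num.sqrt (e / 2) = Num.sqrt (1 / 2) * Num.sqrt e.
  by rewrite mulrC mul1r sqrtrM.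
have hTV : (`|r pr - r pd|%:E <=
    TV (pred_law Q (law P Theta_r) pr) (pred_law Q (law P Theta_r) pd))%E.
  by apply: ereal_sup_ubound; exists B => //; rewrite !rE.
apply: le_trans (leeD2l _ hTV); rewrite uE rE -EFinB -EFinD lee_fin.
rewrite sqrt_half in hu; rewrite sqrt_half in hr.
(* The chain runs [u pd], [u pr], [c], [r pr], [r pd]. *)
have t1 := ler_distD (u pr) (u pd) (r pd).
have t2 := ler_distD c (u pr) (r pd).
have t3 := ler_distD (r pr) c (r pd).
rewrite (distrC (u pd) (u pr)) in t1; rewrite (distrC c (r pr)) in t3.
move: hu hr; rewrite -/(u pr) -/(r pr) => hu hr.
rewrite mulrDr; lra.
Qed.
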